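(* Any element $\delta\in(\mathfrak{f}_{4,\mathbb{R}})^{\mathbb{C}}$ is uniquely expressed as $$\delta=\tilde A_1(c_1)+\tilde A_2(c_2)+\tilde A_3(c_3),\qquad c_i\in\mathbb{C}.$$ In particular, $\dim_{\mathbb{C}}((\mathfrak{f}_{4,\mathbb{R}})^{\mathbb{C}})=3$.
   Context: Let $(\mathfrak{J}_{\mathbb{R}})^{\mathbb{C}}$ be the space of symmetric $3\times 3$ complex matrices with $X\circ Y=\frac12(XY+YX)$. Let $(\mathfrak{f}_{4,\mathbb{R}})^{\mathbb{C}}=\{\delta\in\mathrm{Hom}_{\mathbb{C}}((\mathfrak{J}_{\mathbb{R}})^{\mathbb{C}})\mid\delta(X\circ Y)=\delta X\circ Y+X\circ\delta Y\ \forall X,Y\}$ be its derivation algebra ($\mathrm{Hom}_{\mathbb{C}}(V)$ denotes $\mathbb{C}$-linear endomorphisms of $V$). For $c\in\mathbb{C}$ let $A_1(c)=\begin{pmatrix}0&0&0\\0&0&c\\0&-c&0\end{pmatrix}$, $A_2(c)=\begin{pmatrix}0&0&-c\\0&0&0\\c&0&0\end{pmatrix}$, $A_3(c)=\begin{pmatrix}0&c&0\\-c&0&0\\0&0&0\end{pmatrix}$, and let $\tilde A_i(c)\in(\mathfrak{f}_{4,\mathbb{R}})^{\mathbb{C}}$ be defined by $\tilde A_i(c)X=\frac12(A_i(c)X-XA_i(c))$. *)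

(* Defs.v *)
From HB Require Import structures.
From mathcomp Require Import all_boot all_order all_algebra.
From mathcomp Require Import reals complex ring.

Set Implicit Arguments.
Unset Strict Implicit.
Unset Printing Implicit Defensive.

Import GRing.Theory.
Local Open Scope ring_scope.

Section JordanAlgebra.
Variable F : fieldType.

Definition trmx_defect (X : 'M[F]_3) : 'M[F]_3 := X - X^T.

Fact trmx_defect_is_linear : linear trmx_defect.
Proof.
move=> a X Y.
by rewrite /trmx_defect linearP /= opprD addrACA -scalerBr.
Qed.
HB.instance Definition _ :=
  GRing.isLinear.Build F 'M[F]_3 'M[F]_3 _ trmx_defect trmx_defect_is_linear.

Definition symJR : {vspace 'M[F]_3} := lker (linfun trmx_defect).

Lemma mem_symJR (X : 'M[F]_3) : (X \in symJR) = (X^T == X).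
Proof. by rewrite memv_ker lfunE /= subr_eq0 eq_sym. Qed.

Definition JR := subvs_of symJR.

Lemma trmx_JR (X : JR) : (vsval X)^T = vsval X.
Proof. by apply/eqP; rewrite -mem_symJR subvsP. Qed.

(* [vsproj symJR] only retypes here: its argument is already symmetric, see
   [val_jmul]. *)
Definition jmul (X Y : JR) : JR :=
  vsproj symJR (2^-1 *: (vsval X *m vsval Y + vsval Y *m vsval X)).

Lemma val_jmul (X Y : JR) :
  vsval (jmul X Y) = 2^-1 *: (vsval X *m vsval Y + vsval Y *m vsval X).
Proof.
rewrite vsprojK // mem_symJR linearZ linearD /= !trmx_mul !trmx_JR.
by rewrite [X in _ *: X]addrC.
Qed.

Lemma jmulC (X Y : JR) : jmul X Y = jmul Y X.
Proof. by rewrite /jmul addrC. Qed.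

Lemma jmulPr (X : JR) a (Y Z : JR) :
  jmul X (a *: Y + Z) = a *: jmul X Y + jmul X Z.
Proof.
apply: val_inj; rewrite [LHS]val_jmul [RHS]linearP /= !val_jmul.
rewrite mulmxDr mulmxDl -!scalemxAr -!scalemxAl.
by rewrite addrACA !scalerDr !scalerA mulrC.
Qed.

Lemma jmulPl (X : JR) a (Y Z : JR) :
  jmul (a *: Y + Z) X = a *: jmul Y X + jmul Z X.
Proof. by rewrite !(jmulC _ X) jmulPr. Qed.

Definition derivation (d : 'End(JR)) : Prop :=
  forall X Y : JR, d (jmul X Y) = jmul (d X) Y + jmul X (d Y).

Definition leibniz_defect (d : 'End(JR)) (X Y : JR) : JR :=
  d (jmul X Y) - (jmul (d X) Y + jmul X (d Y)).

Lemma defect_comb a (u1 u2 u3 v1 v2 v3 : JR) :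
  (a *: u1 + v1) - ((a *: u2 + v2) + (a *: u3 + v3))
    = a *: (u1 - (u2 + u3)) + (v1 - (v2 + v3)).
Proof. by rewrite [X in _ - X]addrACA -scalerDr opprD addrACA -scalerBr. Qed.

Fact leibniz_defect_linear_r d X : linear (leibniz_defect d X).
Proof.
move=> a Y Z; rewrite /leibniz_defect [d (a *: Y + Z)]linearP !jmulPr linearP.
exact: defect_comb.
Qed.
HB.instance Definition _ d X :=
  GRing.isLinear.Build F JR JR _ (leibniz_defect d X)
    (leibniz_defect_linear_r d X).

Definition leibniz_defect1 (d : 'End(JR)) (X : JR) : 'End(JR) :=
  linfun (leibniz_defect d X).

Fact leibniz_defect1_linear d : linear (leibniz_defect1 d).
Proof.
move=> a X Y; apply/lfunP => Z; rewrite add_lfunE scale_lfunE !lfunE /=.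
rewrite /leibniz_defect [d (a *: X + Y)]linearP !jmulPl linearP.
exact: defect_comb.
Qed.
HB.instance Definition _ d :=
  GRing.isLinear.Build F JR 'End(JR) _ (leibniz_defect1 d)
    (leibniz_defect1_linear d).

Definition leibniz_defect2 (d : 'End(JR)) : 'Hom(JR, 'End(JR)) :=
  linfun (leibniz_defect1 d).

Lemma leibniz_defect2E d X Y : leibniz_defect2 d X Y = leibniz_defect d X Y.
Proof. by rewrite lfunE /= lfunE. Qed.

Fact leibniz_defect2_linear : linear leibniz_defect2.
Proof.
move=> a d e; apply/lfunP => X; apply/lfunP => Y.
rewrite !(add_lfunE, scale_lfunE) !leibniz_defect2E.
rewrite /leibniz_defect !add_lfunE !scale_lfunE jmulPl jmulPr.
exact: defect_comb.
Qed.
HB.instance Definition _ :=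
  GRing.isLinear.Build F 'End(JR) 'Hom(JR, 'End(JR)) _ leibniz_defect2
    leibniz_defect2_linear.

(* Curried kernel form, so that the derivations are a subspace with a \dim;
   [f4RP] is the defining property. *)
Definition f4R : {vspace 'End(JR)} := lker (linfun leibniz_defect2).

Lemma f4RP (d : 'End(JR)) : reflect (derivation d) (d \in f4R).
Proof.
rewrite memv_ker lfunE /=; apply: (iffP eqP) => [d0 X Y | dD].
  apply/eqP; rewrite -subr_eq0 -/(leibniz_defect d X Y); apply/eqP.
  have := congr1 (fun h : 'Hom(JR, 'End(JR)) => h X Y) d0.
  by rewrite leibniz_defect2E !lfunE.
apply/lfunP => X; apply/lfunP => Y; rewrite leibniz_defect2E !lfunE /=.
by rewrite /leibniz_defect dD subrr.
Qed.

Definition mx3 (s : seq (seq F)) : 'M[F]_3 :=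
  \matrix_(i < 3, j < 3) nth 0 (nth [::] s i) j.

Definition A1 (c : F) : 'M[F]_3 :=
  mx3 [:: [:: 0;   0; 0];
          [:: 0;   0; c];
          [:: 0; - c; 0]].

Definition A2 (c : F) : 'M[F]_3 :=
  mx3 [:: [:: 0; 0; - c];
          [:: 0; 0;   0];
          [:: c; 0;   0]].

Definition A3 (c : F) : 'M[F]_3 :=
  mx3 [:: [::   0; c; 0];
          [:: - c; 0; 0];
          [::   0; 0; 0]].

(* As for [jmul], the projection is the identity when [A] is skew-symmetric,
   see [val_tildeA]; all the uses below are at such an [A]. *)
Definition half_bracket (A : 'M[F]_3) (X : JR) : JR :=
  vsproj symJR (2^-1 *: (A *m vsval X - vsval X *m A)).

Fact half_bracket_linear A : linear (half_bracket A).
Proof.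
move=> a X Y; rewrite /half_bracket -linearP; congr (vsproj _ _).
rewrite [vsval (a *: X + Y)]linearP /= mulmxDr mulmxDl -!scalemxAr.
rewrite -!scalemxAl opprD addrACA.
by rewrite -scalerBr scalerDr !scalerA mulrC.
Qed.
HB.instance Definition _ A :=
  GRing.isLinear.Build F JR JR _ (half_bracket A) (half_bracket_linear A).

Definition tildeA (A : 'M[F]_3) : 'End(JR) := linfun (half_bracket A).

Lemma val_tildeA (A : 'M[F]_3) (X : JR) : A^T = - A ->
  vsval (tildeA A X) = 2^-1 *: (A *m vsval X - vsval X *m A).
Proof.
move=> skA; rewrite lfunE vsprojK // mem_symJR linearZ linearB /= !trmx_mul.
by rewrite !trmx_JR skA mulmxN mulNmx opprK addrC.
Qed.

Definition tA1 (c : F) : 'End(JR) := tildeA (A1 c).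
Definition tA2 (c : F) : 'End(JR) := tildeA (A2 c).
Definition tA3 (c : F) : 'End(JR) := tildeA (A3 c).

Lemma mx3_skew (a b c : F) :
  (mx3 [:: [:: 0; a; b]; [:: - a; 0; c]; [:: - b; - c; 0]])^T
    = - mx3 [:: [:: 0; a; b]; [:: - a; 0; c]; [:: - b; - c; 0]].
Proof.
apply/matrixP => i j; rewrite !mxE.
case: i => [[|[|[|//]]] ?]; case: j => [[|[|[|//]]] ?];
  by rewrite /= ?opprK ?oppr0.
Qed.

Lemma A1_skew c : (A1 c)^T = - A1 c.
Proof. by have := mx3_skew 0 0 c; rewrite oppr0. Qed.

Lemma A2_skew c : (A2 c)^T = - A2 c.
Proof. by have := mx3_skew 0 (- c) 0; rewrite oppr0 opprK. Qed.

Lemma A3_skew c : (A3 c)^T = - A3 c.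
Proof. by have := mx3_skew c 0 0; rewrite oppr0. Qed.

Lemma tildeA_f4R (A : 'M[F]_3) : A^T = - A -> tildeA A \in f4R.
Proof.
move=> skA; apply/f4RP => X Y; apply: val_inj; rewrite [val]/=.
rewrite linearD /= !val_jmul !val_tildeA // !val_jmul.
set x := vsval X; set y := vsval Y.
rewrite -!scalemxAr -!scalemxAl -scalerBr -!scalerDr; congr (_ *: (_ *: _)).
rewrite !(mulmxDr, mulmxDl, mulmxN, mulNmx) !mulmxA.
move: (A *m x *m y) (A *m y *m x) (x *m y *m A) (y *m x *m A).
move: (x *m A *m y) (y *m A *m x) => b1 b2 a1 a2 c1 c2.
by apply/matrixP => i j; rewrite !mxE; ring.
Qed.

Lemma tA1_f4R c : tA1 c \in f4R. Proof. exact/tildeA_f4R/A1_skew. Qed.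
Lemma tA2_f4R c : tA2 c \in f4R. Proof. exact/tildeA_f4R/A2_skew. Qed.
Lemma tA3_f4R c : tA3 c \in f4R. Proof. exact/tildeA_f4R/A3_skew. Qed.

End JordanAlgebra.

(* Main.v *)
(* For a derivation [d], the relations [E_i o E_i = E_i] and [E_i o E_j = 0]
   between the diagonal idempotents force the entries of [d E_i] to vanish
   outside row and column [i] and to be skew in [(i, j)]; so some [tildeA A],
   with [A] skew-symmetric, agrees with [d] on all the [E_i].  A derivation
   killing the [E_i] commutes with the Peirce projections
   [X |-> x_ij (E_ij + E_ji)], hence scales each [F_ij := E_ij + E_ji]; as
   [F_ij o F_ij = E_i + E_j] is killed, all the factors vanish. *)
From HB Require Import structures.
Require Import Defs.
From mathcomp Require Import all_boot all_order all_algebra.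
From mathcomp Require Import reals complex.
From mathcomp Require Import ring.
Import GRing.Theory.
Local Open Scope ring_scope.
Local Open Scope complex_scope.

Section Derivations.
Variable F : fieldType.
Hypothesis two_neq0 : 2 != 0 :> F.

Implicit Types (i j k l : 'I_3) (X Y : JR F) (A B : 'M[F]_3).
Implicit Types (d : 'End(JR F)) (c : F * F * F).

(** * Diagonal idempotents and Peirce components *)

Definition sym_unit i j : JR F := vsproj (symJR F) (delta_mx i j + delta_mx j i).
Definition idem i : JR F := vsproj (symJR F) (delta_mx i i).

Lemma val_sym_unit i j : vsval (sym_unit i j) = delta_mx i j + delta_mx j i.
Proof. by rewrite vsprojK // mem_symJR linearD /= !trmx_delta addrC. Qed.

Lemma val_idem i : vsval (idem i) = delta_mx i i.
Proof. by rewrite vsprojK // mem_symJR trmx_delta. Qed.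

Lemma JR_entryC X i j : vsval X i j = vsval X j i.
Proof. by rewrite -[in LHS]trmx_JR mxE. Qed.

Lemma mul_delta_diagE A i k l : (delta_mx i i *m A) k l = (k == i)%:R * A k l.
Proof.
rewrite mxE (bigD1 i) //= big1 => [|j /negPf ji]; rewrite !mxE.
  by rewrite eqxx andbT addr0; case: eqP => [->|]; rewrite ?mul0r.
by rewrite ji andbF mul0r.
Qed.

Lemma mul_diag_deltaE A i k l : (A *m delta_mx i i) k l = A k l * (l == i)%:R.
Proof.
rewrite mxE (bigD1 i) //= big1 => [|j /negPf ji]; rewrite !mxE.
  by rewrite eqxx addr0; case: eqP => [->|]; rewrite ?mulr0.
by rewrite ji mulr0.
Qed.

(** Multiplication by [idem i] is diagonal on entries, with the Peirce eigenvalues 0, 1/2 and 1. *)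
Lemma jmul_idemE i X k l :
  vsval (jmul (idem i) X) k l =
    2^-1 * ((k == i)%:R + (l == i)%:R) * vsval X k l.
Proof.
rewrite val_jmul mxE [X in _ * X]mxE val_idem mul_delta_diagE mul_diag_deltaE.
by rewrite [X in _ + X]mulrC -mulrDl mulrA.
Qed.

Lemma jmul_idem i j : jmul (idem i) (idem j) = (i == j)%:R *: idem i.
Proof.
apply: val_inj; apply/matrixP => k l.
rewrite [LHS]jmul_idemE [val]/= linearZ /= !val_idem !mxE.
have [->|/negPf ij] := eqVneq i j; case: (eqVneq k j) => [kj|] /=;
  case: (eqVneq l j) => [lj|] //=; rewrite ?kj ?lj ?mulr0 ?mul0r //.
  by field.
by rewrite (eq_sym j) ij addr0 mulr0 mul0r.
Qed.

(** A polynomial in the multiplications by [idem i] and [idem j], so any derivation killing the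
    idempotents commutes with it. For [i != j] it is the Peirce projection. On the diagonal the
    correction term removes the eigenvalue 1/2, and twice the projection remains, matching
    [sym_unit i i = 2 *: idem i]. *)
Definition peirce i j X : JR F :=
  2 *: (jmul (idem i) (jmul (idem j) X) + jmul (idem j) (jmul (idem i) X))
  - ((i == j)%:R * 2) *: jmul (idem i) X.

Lemma peirceE i j X : peirce i j X = vsval X i j *: sym_unit i j.
Proof.
apply: val_inj; apply/matrixP => k l; rewrite [val]/=.
rewrite linearB !linearZ linearD /= val_sym_unit !mxE !jmul_idemE.
have [<-|/negPf ij] := eqVneq i j;
  case: (eqVneq k i) => [ki|_]; case: (eqVneq l i) => [li|_];
  rewrite ?ki ?li ?ij ?eqxx /= ?mulr1n ?mulr0n; try by field.
- case: (eqVneq l j) => [->|_]; rewrite /= ?mulr1n ?mulr0n; by field.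
- case: (eqVneq k j) => [->|_]; rewrite /= ?mulr1n ?mulr0n; last by field.
  by rewrite (JR_entryC X j i); field.
- case: (eqVneq k j) => [->|_]; case: (eqVneq l j) => [->|_];
  rewrite /= ?mulr1n ?mulr0n; by field.
Qed.

Lemma derivation_eq0 d :
  derivation d -> (forall i, d (idem i) = 0) -> d = 0.
Proof.
move=> dD d0.
have jmul0l X : jmul 0 X = 0.
  by apply: val_inj; rewrite [val]/= [LHS]val_jmul linear0 mul0mx mulmx0 addr0 scaler0.
have dE i X : d (jmul (idem i) X) = jmul (idem i) (d X).
  by rewrite dD d0 jmul0l add0r.
have dP i j X : d (peirce i j X) = peirce i j (d X).
  by rewrite /peirce linearB !linearZ linearD /= !dE.
have dU i j : d (sym_unit i j) = 0.
  have [<-|ij] := eqVneq i j.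
    have -> : sym_unit i i = 2 *: idem i.
      apply: val_inj; rewrite [val]/= linearZ /= val_sym_unit val_idem.
      by rewrite scaler_nat mulr2n.
    by rewrite linearZ /= d0 scaler0.
  have Uij : vsval (sym_unit i j) i j = 1.
    by rewrite val_sym_unit !mxE !eqxx (negPf ij) addr0.
  (* [peirce i j] fixes [sym_unit i j], so [d] multiplies it by a scalar [a]. *)
  have := dP i j (sym_unit i j); rewrite !peirceE Uij scale1r.
  set a := vsval (d _) i j => dUa.
  have UU : jmul (sym_unit i j) (sym_unit i j) = idem i + idem j.
    apply: val_inj; rewrite [LHS]val_jmul [val]/= linearD /= val_sym_unit !val_idem.
    rewrite mulmxDl !mulmxDr !mul_delta_mx_cond !eqxx (negPf ij) eq_sym (negPf ij).
    rewrite !mulr0n !mulr1n add0r addr0 -scalerDr -mulr2n -scaler_nat scalerA.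
    by rewrite mulVf // scale1r.
  have := dD (sym_unit i j) (sym_unit i j); rewrite UU linearD /= !d0 addr0 dUa.
  rewrite -[a *: _]addr0 jmulPl jmulPr jmul0l (jmulC _ 0) jmul0l !addr0.
  move/esym/eqP; rewrite -mulr2n -scaler_nat scalerA UU scaler_eq0.
  rewrite mulf_eq0 (negPf two_neq0) /=; case/orP => [/eqP->|].
    by rewrite scale0r.
  (* The alternative [idem i + idem j = 0] fails at entry [(i, i)], which is 1. *)
  move/eqP/(congr1 (fun X : JR F => vsval X i i)).
  rewrite linearD linear0 /= !val_idem !mxE !eqxx (negPf ij) addr0.
  by move/eqP; rewrite oner_eq0.
apply/lfunP => X; apply: val_inj; apply/matrixP => i j.
(* Every Peirce component of [d X] vanishes; entry [(i, j)] of [sym_unit i j] is 1 or 2, hence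
   invertible. *)
have := dP i j X; rewrite !peirceE linearZ /= dU scaler0.
move/(congr1 (fun X : JR F => vsval X i j)).
rewrite linear0 linearZ /= val_sym_unit !mxE !eqxx /= zero_lfunE linear0 mxE.
move/esym/eqP; rewrite mulf_eq0 => /orP[/eqP //|].
case: (_ && _); rewrite /= ?addr0 ?oner_eq0 // => two0.
by rewrite -[1 + 1]/(2 : F) (negPf two_neq0) in two0.
Qed.

(** * Values of a derivation on the idempotents *)

Lemma derivation_idemE d i k l : derivation d ->
  vsval (d (idem i)) k l =
    ((k == i)%:R + (l == i)%:R) * vsval (d (idem i)) k l.
Proof.
move=> dD; have := dD (idem i) (idem i).
rewrite jmul_idem eqxx scale1r (jmulC (d _)) => e.
rewrite {1}e linearD /= mxE jmul_idemE; by field.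
Qed.

Lemma derivation_idem_skew d i j : derivation d -> i != j ->
  vsval (d (idem j)) i j = - vsval (d (idem i)) i j.
Proof.
move=> dD ij; have := dD (idem i) (idem j).
rewrite jmul_idem (negPf ij) scale0r linear0 jmulC.
move/(congr1 (fun X : JR F => vsval X i j)).
rewrite linear0 linearD /= !mxE !jmul_idemE !eqxx (negPf ij) eq_sym (negPf ij).
rewrite add0r addr0 !mulr1 -mulrDr => /esym/eqP.
by rewrite mulf_eq0 invr_eq0 (negPf two_neq0) /= addrC addr_eq0 => /eqP.
Qed.

Lemma tildeA_idemE A i k l : A^T = - A ->
  vsval (tildeA A (idem i)) k l =
    2^-1 * ((l == i)%:R - (k == i)%:R) * A k l.
Proof.
move=> skA; rewrite val_tildeA // val_idem mxE mxE mul_diag_deltaE [X in _ + X]mxE.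
by rewrite mul_delta_diagE; ring.
Qed.

Lemma derivation_tildeA d : derivation d ->
  exists2 A, A^T = - A & d = tildeA A.
Proof.
(* The factor -2 inverts the -1/2 by which [tildeA A (idem i)] carries row [i] of [A] off the
   diagonal. *)
move=> dD; pose A : 'M[F]_3 := \matrix_(i, j) (- 2 * vsval (d (idem i)) i j).
(* At [(i, i)] the weight in [derivation_idemE] is 2, so the entry equals its own double. *)
have diag0 i : vsval (d (idem i)) i i = 0.
  have /eqP := derivation_idemE d i i i dD.
  by rewrite eqxx mulrDl mul1r -subr_eq subrr eq_sym => /eqP.
have skA : A^T = - A.
  apply/matrixP => i j; rewrite !mxE.
  have [->|ij] := eqVneq i j; first by rewrite diag0 mulr0 oppr0.
  by rewrite JR_entryC derivation_idem_skew // mulrN.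
exists A => //; apply/eqP; rewrite -subr_eq0; apply/eqP.
have /f4RP dAD := tildeA_f4R skA.
apply: derivation_eq0.
  by apply/f4RP; rewrite rpredB //; apply/f4RP.
move=> i; apply: val_inj; apply/matrixP => k l.
rewrite [val]/= linear0 add_lfunE opp_lfunE linearB /= [RHS]mxE mxE.
rewrite [X in _ + X]mxE tildeA_idemE // derivation_idemE // mxE.
have [->|ki] := eqVneq k i; have [->|li] := eqVneq l i.
- by rewrite diag0 !mulr0 subrr.
- by rewrite /=; field.
(* In column [i] the entry of [A] comes from [d (idem k)]; skewness turns it into one of
   [d (idem i)]. *)
- by rewrite /= derivation_idem_skew //; field.
- by rewrite /=; field.
Qed.

(** * Skew-symmetric matrices and their coordinates *)

Lemma skew_entry A i j : A^T = - A -> A j i = - A i j.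
Proof.
by move=> skA; have := congr1 (fun M : 'M[F]_3 => M i j) skA; rewrite !mxE.
Qed.

Lemma skew_diag A i : A^T = - A -> A i i = 0.
Proof.
move/(skew_entry A i i)/eqP.
by rewrite -addr_eq0 -mulr2n -mulr_natl mulf_eq0 (negPf two_neq0) => /eqP.
Qed.

(** Entry [(i, j)] of [tildeA A (idem j)] is half of [A i j] when [i != j], and skewness settles the
    diagonal. *)
Lemma tildeA_inj A B : A^T = - A -> B^T = - B -> tildeA A = tildeA B -> A = B.
Proof.
move=> skA skB AB; apply/matrixP => i j.
have [->|ij] := eqVneq i j; first by rewrite !skew_diag.
have := congr1 (fun d : 'End(JR F) => vsval (d (idem j)) i j) AB.
rewrite !tildeA_idemE // eqxx (negPf ij) subr0 mulr1.
by apply: mulfI; rewrite invr_eq0.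
Qed.

(** The matrix of the cross product [v |-> v x c] on column vectors. *)
Definition skew c : 'M[F]_3 := A1 c.1.1 + A2 c.1.2 + A3 c.2.

Lemma skewE c : skew c =
  mx3 [:: [:: 0; c.2; - c.1.2]; [:: - c.2; 0; c.1.1]; [:: c.1.2; - c.1.1; 0]].
Proof.
apply/matrixP => i j; rewrite !mxE.
case: i => [[|[|[|//]]] ?]; case: j => [[|[|[|//]]] ?];
  by rewrite /= ?add0r ?addr0.
Qed.

Lemma skew_skew c : (skew c)^T = - skew c.
Proof. by rewrite /skew !linearD /= A1_skew A2_skew A3_skew. Qed.

Lemma skew_inj : injective skew.
Proof.
move=> [[a1 a2] a3] [[b1 b2] b3]; rewrite !skewE => /matrixP e.
have := e (inord 1) (inord 2); have := e (inord 2) (inord 0).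
have := e (inord 0) (inord 1); rewrite !mxE !inordK //=.
by move=> -> -> ->.
Qed.

Lemma skewP A : A^T = - A -> exists c, A = skew c.
Proof.
(* These are the positions where [skew] holds its coordinates without a sign. *)
move=> skA; exists (A (inord 1) (inord 2), A (inord 2) (inord 0), A (inord 0) (inord 1)).
rewrite skewE; apply/matrixP => i j; rewrite !mxE /=.
rewrite -(inord_val i) -(inord_val j).
case: i => [[|[|[|//]]] ?]; case: j => [[|[|[|//]]] ?];
  by rewrite /= ?inordK //= ?skew_diag // -skew_entry.
Qed.

Lemma tildeA_skew c : tildeA (skew c) = tA1 c.1.1 + tA2 c.1.2 + tA3 c.2.
Proof.
apply/lfunP => X; rewrite !add_lfunE; apply: val_inj; rewrite [val]/=.
rewrite !linearD /= !val_tildeA ?skew_skew ?A1_skew ?A2_skew ?A3_skew //.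
rewrite -!scalerDr; congr (_ *: _).
by rewrite /skew !mulmxDl !mulmxDr !opprD addrACA [X in X + _ = _]addrACA.
Qed.

(** [F^o] makes the triples a vector space over [F], so that dimensions can be compared along a
    linear map. *)
Definition tildeA_of (c : F^o * F^o * F^o) : 'End(JR F) := tildeA (skew c).

Fact tildeA_of_linear : linear tildeA_of.
Proof.
move=> a c c'; apply/lfunP => X; rewrite add_lfunE scale_lfunE.
apply: val_inj; rewrite [val]/= linearP /= !val_tildeA ?skew_skew //.
have -> : skew (a *: c + c') = a *: skew c + skew c'.
  rewrite !skewE; apply/matrixP => i j; rewrite !mxE.
  by case: i => [[|[|[|//]]] ?]; case: j => [[|[|[|//]]] ?];
    rewrite /= /GRing.scale /=; ring.
rewrite mulmxDl mulmxDr -scalemxAl -scalemxAr opprD addrACA -scalerBr.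
by rewrite scalerDr !scalerA mulrC.
Qed.
HB.instance Definition _ :=
  GRing.isLinear.Build F (F^o * F^o * F^o)%type 'End(JR F) _ tildeA_of
    tildeA_of_linear.

Lemma tildeA_of_inj : injective tildeA_of.
Proof.
by move=> c c' /tildeA_inj e; apply/skew_inj/e; apply: skew_skew.
Qed.

Lemma f4R_tildeA_of d : d \in f4R F -> exists c, d = tildeA_of c.
Proof.
case/f4RP/derivation_tildeA => A /skewP[c ->] ->.
by exists c.
Qed.

(** The derivations are the image of the injective linear map [tildeA_of] on a space of dimension
    3. *)
Lemma dim_f4R : \dim (f4R F) = 3%N.
Proof.
have -> : f4R F = limg (linfun tildeA_of).
  apply/eqP; rewrite eqEsubv; apply/andP; split; apply/subvP => d.
    by case/f4R_tildeA_of => c ->; apply/memv_imgP; exists c;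
      rewrite ?memvf ?lfunE.
  case/memv_imgP => c _ ->; rewrite lfunE /=.
  exact/tildeA_f4R/skew_skew.
rewrite limg_dim_eq ?dimvf //.
suff /eqP-> : lker (linfun tildeA_of) == 0%VS by rewrite capv0.
by apply/lker0P => c c'; rewrite !lfunE; apply: tildeA_of_inj.
Qed.

End Derivations.

Theorem theorem3p5 (R : realType) :
  (forall delta : 'End(JR R[i]), delta \in f4R R[i] ->
     exists! c : R[i] * R[i] * R[i],
       let '(c1, c2, c3) := c in delta = tA1 c1 + tA2 c2 + tA3 c3)
  /\ \dim (f4R R[i]) = 3%N.
Proof.
have two_neq0 : 2 != 0 :> R[i] by rewrite Num.Theory.pnatr_eq0.
split; last exact: dim_f4R.
move=> delta /(f4R_tildeA_of _ two_neq0)[c ->].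
exists c; split=> [|c' ec']; first by case: c => -[c1 c2] c3; exact: tildeA_skew.
apply: (tildeA_of_inj _ two_neq0); rewrite [RHS]tildeA_skew.
by case: c' ec' => -[c1 c2] c3.
Qed.
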